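(* Let $s\in\mathbb{C}$ with $\Re(s)<1$. Then the set of values $|\mathrm{WAM}(abc,s)|$, where $(a,b,c)$ ranges over ABC triples of integers with $|abc|>1$ for which $\mathrm{WAM}(abc,s)$ is defined, is unbounded.
   Context: For an integer $n$ with $|n|>1$ and prime factorisation $n=\pm\prod_{k=1}^m p_k^{e_k}$ (distinct primes $p_1<\dots<p_m$, $e_k\ge 1$) and $s\in\mathbb{C}$, define the weighted average multiplicity $$\mathrm{WAM}(n,s)=\frac{\sum_{k=1}^m e_k(\log p_k)^s}{\sum_{k=1}^m(\log p_k)^s},$$ where $(\log p)^s=\exp(s\log\log p)$; it is defined whenever the denominator is nonzero. An ABC triple of integers is a triple $(a,b,c)$ of coprime integers with $a+b=c$. *)

(* Defs.v *)
From HB Require Import structures.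
From mathcomp Require Import all_boot all_order all_algebra.
From mathcomp Require Import all_classical all_reals all_analysis.
From mathcomp Require Import complex.
Set Implicit Arguments.
Unset Strict Implicit.
Unset Printing Implicit Defensive.

Import Order.TTheory GRing.Theory Num.Theory.
Import ComplexField.Normc.

Local Open Scope ring_scope.
Local Open Scope complex_scope.

Definition cexp (R : realType) (z : R[i]) : R[i] :=
  (expR (complex.Re z) * cos (complex.Im z))
    +i* (expR (complex.Re z) * sin (complex.Im z)).

(* (log p)^s = exp (s log log p); for p = 2 the number log log p is negative,
   but [ln] is only applied to positive reals as soon as 1 < p *)
Definition logpow (R : realType) (p : nat) (s : R[i]) : R[i] :=
  cexp (s * (ln (ln (p%:R : R)))%:C).

Definition WAM_den (R : realType) (n : int) (s : R[i]) : R[i] :=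
  \sum_(p <- primes `|n|%N) logpow p s.

(* Division is total, with x / 0 = 0: WAM is only meaningful under
   [WAM_defined] below. *)
Definition WAM (R : realType) (n : int) (s : R[i]) : R[i] :=
  (\sum_(p <- primes `|n|%N) (logn p `|n|%N)%:R * logpow p s) / WAM_den n s.

Definition WAM_defined (R : realType) (n : int) (s : R[i]) : Prop :=
  (1 < `|n|%N)%N /\ WAM_den n s != 0.

(* gcd (a, b, c) = 1; since a + b = c this is the same as pairwise coprimality *)
Definition ABC_triple (a b c : int) : Prop :=
  gcdz a (gcdz b c) = 1 /\ a + b = c.

Definition abs_WAM_values (R : realType) (s : R[i]) : set R :=
  [set x : R | exists a b c : int,
    [/\ ABC_triple a b c, WAM_defined (a * b * c) s
      & x = normc (WAM (a * b * c) s)]]%classic.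

(* Main.v *)
(* Consider ABC triples in which one entry is 2^k with k >= n, another is 1 and
   the third is an odd divisor m of 2^(2n) - 1.  Put sigma = Re s < 1 and
   S = sum_(p | m) e_p (log p)^sigma.  Since (log p)^sigma <= eps log p for large
   p, the large primes contribute at most eps log m <= 2 eps n to S; a suitable
   choice of n keeps all small odd primes out of 2^(2n) - 1 except a single
   factor 3.  Hence |WAM| >= (k (log 2)^sigma - S) / ((log 2)^sigma + S) is
   large as soon as the denominator of WAM does not vanish.  Finally, the
   denominators attached to m = 2^n - 1, 2^(2n) - 1 and 2^n + 1 are L + D1,
   L + D1 + D2 and L + D2 with L = (log 2)^s <> 0, and these cannot all be 0. *)
Require Import Defs.
From mathcomp Require Import all_boot all_order all_algebra.
From mathcomp Require Import all_classical all_reals all_analysis.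
From mathcomp Require Import complex.
From mathcomp Require Import cyclic zify ring lra.

Set Implicit Arguments.
Unset Strict Implicit.
Unset Printing Implicit Defensive.

Import Order.TTheory GRing.Theory Num.Theory.
Import ComplexField.Normc.

(** * Small prime factors of 2^(2n) - 1 *)

Lemma exists_exponent (B k : nat) : exists2 n : nat, k <= n &
  forall p, prime p -> p < B -> p %| (2 ^ (2 * n)).-1 ->
    p = 3 /\ logn 3 (2 ^ (2 * n)).-1 <= 1.
Proof.
(* With n = 1 mod totient Q, 2^(2n) - 1 is 3 modulo Q, and Q is divisible by 9
   and by every odd prime below B. *)
pose N := 9 * B`!; pose Q := N`_2^'.
have N0 : (0 < N) by rewrite muln_gt0 fact_gt0.
have coQ : coprime 2 Q.
  by apply: (@pnat_coprime 2); [exact: pnat_id | exact: part_pnat].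
have Qodd d : odd d -> (d %| N) -> (d %| Q).
  move=> od dN; rewrite -(@Gauss_dvdr d N`_2) ?partnC //.
  by rewrite p_part coprimeXr // coprime_sym prime_coprime // dvdn2 od.
pose n := (k * totient Q).+1.
have Q0 : (0 < totient Q) by rewrite totient_gt0 part_gt0.
exists n; first by rewrite /n ltnW // ltnS leq_pmulr.
have E : 2 ^ (2 * n) = 4 %[mod Q].
  have -> : (2 * n = 2 + totient Q * (2 * k)) by rewrite /n; lia.
  rewrite expnD -modnMmr expnM -modnXm Euler_exp_totient // modnXm exp1n.
  by rewrite modnMmr.
have X0 : (0 < 2 ^ (2 * n)) by rewrite expn_gt0.
(* Such a [d] divides [Q], hence also 4 - 1. Taking [d = p] forces [p = 3], and [d = 9] bounds the
   multiplicity of 3. *)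
have H d : odd d -> (d %| N) -> (d %| (2 ^ (2 * n)).-1) -> (d %| 3).
  move=> od /(Qodd _ od) dQ; rewrite -subn1 -eqn_mod_dvd // => /eqP e1.
  have -> : 3 = (4 - 1) by [].
  rewrite -eqn_mod_dvd //; apply/eqP; rewrite -e1.
  by move: E => /(congr1 (fun x => x %% d)); rewrite !modn_dvdm.
move=> p pp pB pM; split.
  have op : odd p.
    case: (even_prime pp) => // p2; move: pM; rewrite p2 dvdn2.
    by rewrite -subn1 oddB // oddX muln_eq0 /n.
  have : (p %| 3) by apply: H => //; rewrite dvdn_mull // dvdn_fact // prime_gt0 // ltnW.
  by rewrite dvdn_prime2 // => /eqP.
rewrite leqNgt -(pfactor_dvdn 2) //; last first.
  by rewrite -subn1 subn_gt0 -[1]/(2 ^ 0) ltn_exp2l.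
by apply/negP => /H; rewrite dvdn_mulr // => /(_ isT isT).
Qed.

Local Open Scope ring_scope.

(** * Sums over prime divisors weighted by powers of log p *)

Section Weights.
Variable R : realType.
Implicit Types (sigma eps : R) (s : R[i]).

(** The real power (log p)^sigma, which is the modulus of [logpow p s] when sigma = Re s. *)
Definition logweight sigma (p : nat) : R := expR (sigma * ln (ln p%:R)).

Lemma logweight_gt0 sigma p : 0 < logweight sigma p.
Proof. exact: expR_gt0. Qed.

Lemma normc_logpow p s : normc (logpow p s) = logweight (complex.Re s) p.
Proof.
case: s => a b; rewrite /logpow /cexp /logweight /=.
rewrite !mulr0 subr0 !exprMn -mulrDr cos2Dsin2 mulr1 sqrtr_sqr ger0_norm //.
Qed.

(** Taking logarithms, the inequality becomes (sigma - 1) log log p <= log eps. As sigma - 1 < 0,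
    this says log log p >= [t]. *)
Lemma logweight_le_ln sigma eps : sigma < 1 -> 0 < eps ->
  exists B : nat, forall p : nat, (B <= p)%N ->
    logweight sigma p <= eps * ln p%:R.
Proof.
move=> s1 e0; pose t := ln eps / (sigma - 1).
exists (Num.bound (expR (expR t))) => p Bp.
have tp : expR (expR t) < p%:R.
  apply: lt_le_trans (archi_boundP (expR_ge0 _)) _.
  by rewrite ler_nat.
have p0 : 0 < p%:R :> R by apply: lt_trans tp; exact: expR_gt0.
have tl : expR t < ln p%:R by rewrite -[ltLHS]expRK ltr_ln ?posrE ?expR_gt0.
have l0 : 0 < ln p%:R :> R by apply: lt_trans tl; exact: expR_gt0.
have tll : t < ln (ln p%:R) by rewrite -[ltLHS]expRK ltr_ln ?posrE ?expR_gt0.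
have -> : eps * ln p%:R = expR (ln eps + ln (ln p%:R)).
  by rewrite expRD !lnK ?posrE.
rewrite /logweight ler_expR.
by move: tll; rewrite /t ltr_ndivrMr ?subr_lt0 //; lra.
Qed.

Lemma ln_prime_sum (m : nat) : (0 < m)%N ->
  \sum_(p <- primes m) (logn p m)%:R * ln p%:R = ln m%:R :> R.
Proof.
move=> m0; rewrite [in RHS](prod_prime_decomp m0) prime_decompE big_map /=.
rewrite big_seq [in RHS]big_seq.
(* Positivity is carried through the induction because [lnM] needs positive factors. *)
have [] : 0 < (\prod_(i <- primes m | i \in primes m) i ^ logn i m)%N%:R :> R /\
  \sum_(i <- primes m | i \in primes m) (logn i m)%:R * ln i%:R =
  ln ((\prod_(i <- primes m | i \in primes m) i ^ logn i m)%N%:R) :> R; last by [].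
apply: (big_ind2 (fun (x : R) (n : nat) => 0 < n%:R :> R /\ x = ln n%:R)).
- by rewrite ln1.
- by move=> x1 n1 x2 n2 [h1 ->] [h2 ->]; rewrite natrM mulr_gt0 // lnM.
- move=> p; rewrite mem_primes => /andP[/prime_gt0 p0 _].
  by rewrite natrX exprn_gt0 ?ltr0n // lnXn ?ltr0n // mulr_natl.
Qed.

(** For sigma = 0 this is Omega(m), the number of prime factors with multiplicity. *)
Definition weighted_Omega sigma (m : nat) : R :=
  \sum_(p <- primes m) (logn p m)%:R * logweight sigma p.

(** Primes from [B] on contribute at most eps times their share of log m; below [B] only a single
    factor 3 can occur. *)
Lemma weighted_Omega_le sigma eps (B m : nat) :
  (forall p : nat, (B <= p)%N -> logweight sigma p <= eps * ln p%:R) ->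
  0 < eps -> (0 < m)%N ->
  (forall p, p \in primes m -> (p < B)%N -> p = 3%N /\ (logn 3 m <= 1)%N) ->
  weighted_Omega sigma m <= logweight sigma 3 + eps * ln m%:R.
Proof.
move=> hB e0 m0 hm.
(* Writing the contribution of 3 as a sum over [primes m] allows a termwise comparison. *)
have h3 : \sum_(p <- primes m | p == 3%N) logweight sigma 3 <= logweight sigma 3.
  rewrite big_const_seq iter_addr_0 count_uniq_mem ?primes_uniq //.
  by case: (_ \in _); rewrite ?mulr1n ?mulr0n // ltW // logweight_gt0.
apply: le_trans (lerD h3 (lexx _)).
rewrite -ln_prime_sum // mulr_sumr big_mkcond -big_split /=.
rewrite /weighted_Omega big_seq [leRHS]big_seq; apply: ler_sum => p pm.
have p1 : (1 < p)%N by move: pm; rewrite mem_primes => /andP[/prime_gt1].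
have lp : 0 <= ln p%:R :> R by rewrite ln_ge0 // ler1n ltnW.
have [Bp|pB] := leqP B p.
  rewrite mulrCA; apply: ler_wpDl; last by rewrite ler_wpM2l // hB.
  by case: ifP => // _; rewrite ltW // logweight_gt0.
have [-> l1] := hm p pm pB; rewrite eqxx.
apply: ler_wpDr; first by rewrite !mulr_ge0 // ?ln_ge0 ?ler1n // ltW.
by rewrite ler_piMl ?lern1 // ltW // logweight_gt0.
Qed.

Definition prime_sum s (m : nat) : R[i] := \sum_(p <- primes m) logpow p s.

Lemma prime_sumM s (m n : nat) : (0 < m)%N -> (0 < n)%N -> coprime m n ->
  prime_sum s (m * n) = prime_sum s m + prime_sum s n.
Proof.
move=> m0 n0 co; rewrite /prime_sum -big_cat; apply/perm_big/uniq_perm.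
- exact: primes_uniq.
- rewrite cat_uniq !primes_uniq andbT /=.
  by rewrite -coprime_has_primes // co.
- by move=> p; rewrite primesM // mem_cat.
Qed.

Lemma prime_sum2X s k : (0 < k)%N -> prime_sum s (2 ^ k) = logpow 2 s.
Proof. by move=> k0; rewrite /prime_sum primesX // primes_prime // big_seq1. Qed.

Lemma normc_sum_le (I : eqType) (r : seq I) (F : I -> R[i]) (G : I -> R) :
  {in r, forall i, normc (F i) <= G i} ->
  normc (\sum_(i <- r) F i) <= \sum_(i <- r) G i.
Proof.
move=> FG; rewrite big_seq [leRHS]big_seq.
apply: (big_ind2 (fun x y => normc x <= y)) => //; first by rewrite normc0.
by move=> x1 x2 y1 y2 h1 h2; apply: le_trans (le_normcD _ _) (lerD h1 h2).
Qed.

Lemma normc_gt0 (z : R[i]) : z != 0 -> 0 < normc z.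
Proof.
move=> z0; rewrite lt_neqAle eq_sym; apply/andP; split.
  by apply: contra z0 => /eqP/eq0_normc ->.
by case: z {z0} => a b; exact: sqrtr_ge0.
Qed.

Lemma normc_natl n (z : R[i]) : normc (n%:R * z) = n%:R * normc z.
Proof. by rewrite mulr_natl normcMn mulr_natl. Qed.

(** The prime 2 dominates: with L = (log 2)^(Re s), the numerator has modulus at least k L - T and
    the denominator at most L + T. *)
Lemma WAM_gt s (K T : R) (k m : nat) (z : int) :
  `|z|%N = (2 ^ k * m)%N -> odd m -> (0 < k)%N -> WAM_den z s != 0 ->
  0 <= K -> weighted_Omega (complex.Re s) m <= T ->
  K * (logweight (complex.Re s) 2 + T) + T < k%:R * logweight (complex.Re s) 2 ->
  K < normc (WAM z s).
Proof.
move=> zE om k0 den0 K0 ST KT.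
have m0 : (0 < m)%N by case: m om {zE ST}.
have co : coprime 2 m by rewrite prime_coprime // dvdn2 om.
have pe : perm_eq (primes `|z|%N) (2%N :: primes m).
  apply: uniq_perm.
  - exact: primes_uniq.
  - rewrite /= primes_uniq andbT mem_primes dvdn2 om /= !andbF //.
  - move=> p; rewrite zE primesM ?expn_gt0 // primesX // primes_prime //.
    by rewrite !inE.
have denE : WAM_den z s = logpow 2 s + prime_sum s m.
  by rewrite /WAM_den (perm_big _ pe) big_cons.
have numE : \sum_(p <- primes `|z|%N) (logn p `|z|%N)%:R * logpow p s =
    k%:R * logpow 2 s + \sum_(p <- primes m) (logn p m)%:R * logpow p s.
  rewrite (perm_big _ pe) big_cons zE; congr (_ + _).
    by rewrite mulnC logn_Gauss // pfactorK.
  apply: eq_big_seq => p pm; rewrite logn_Gauss //.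
  rewrite coprimeXr // coprime_sym (coprime_dvdr _ co) //.
  by move: pm; rewrite mem_primes => /and3P[].
have denN : normc (WAM_den z s) <= logweight (complex.Re s) 2 + T.
  rewrite denE; apply: le_trans (le_normcD _ _) _; rewrite normc_logpow lerD2l.
  apply: le_trans ST; apply: normc_sum_le => p pm; rewrite normc_logpow.
  (* Each prime divisor of [m] has multiplicity at least 1. *)
  by rewrite ler_peMl ?ler1n ?logn_gt0 // ltW // logweight_gt0.
have numN : k%:R * logweight (complex.Re s) 2 - T <=
    normc (\sum_(p <- primes `|z|%N) (logn p `|z|%N)%:R * logpow p s).
  rewrite numE; set x := k%:R * logpow 2 s; set y := \sum_(p <- _) _.
  have yT : normc y <= T.
    apply: le_trans ST; apply: normc_sum_le => p pm.
    by rewrite normc_natl normc_logpow.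
  have xE : normc x = k%:R * logweight (complex.Re s) 2.
    by rewrite normc_natl normc_logpow.
  have := le_normcD (x + y) (- y); rewrite addrK normcN xE; lra.
rewrite /WAM normcM normcV ltr_pdivlMr ?normc_gt0 //.
apply: le_lt_trans (ler_wpM2l K0 denN) _; lra.
Qed.

End Weights.

Theorem theorem1p1 (R : realType) (s : complex R) (hs : (complex.Re s < 1)%R) :
  ~ has_ubound (abs_WAM_values s).
Proof.
case=> K0 ubK.
pose sigma := complex.Re s.
pose L := logweight sigma 2; pose W := logweight sigma 3.
have L0 : 0 < L by exact: logweight_gt0.
have W0 : 0 < W by exact: logweight_gt0.
pose K := `|K0|.
have Kge0 : 0 <= K by exact: normr_ge0.
have K1 : 0 < K + 1 by lra.
(* With this choice (K + 1) eps 2n = n L / 2, while n > [C] keeps K L + (K + 1) W below the other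
   half of n L. *)
pose eps := L / (4 * (K + 1)).
have e0 : 0 < eps by rewrite divr_gt0 // mulr_gt0.
have [B hB] := logweight_le_ln hs e0.
pose C := 2 * (K * L + (K + 1) * W) / L.
have C0 : 0 <= C by rewrite divr_ge0 ?(ltW L0) // mulr_ge0 // addr_ge0 // mulr_ge0 // ltW.
have [n nk hn] := exists_exponent B (Num.bound C).
have Cn : C < n%:R.
  by apply: lt_le_trans (archi_boundP C0) _; rewrite ler_nat.
have n0 : (0 < n)%N by rewrite -(ltr_nat R); exact: le_lt_trans Cn.
pose M := (2 ^ (2 * n)).-1.
have M1 : (1 < 2 ^ n)%N by rewrite -[1%N]/(2 ^ 0)%N ltn_exp2l.
have ME : M = ((2 ^ n).-1 * (2 ^ n).+1)%N.
  by rewrite /M mulnC expnM -[(_ ^ 2)%N]mulnn; nia.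
have o1 : odd (2 ^ n).+1 by rewrite /= oddX orbF -lt0n n0.
have o2 : odd (2 ^ n).-1 by rewrite -subn1 oddB ?oddX ?gtn_eqF // ltnW.
(* A nonzero denominator would give a value above the supposed bound, so all these denominators
   vanish. *)
have hit (k m : nat) (a b c : int) : ABC_triple a b c -> `|(a * b * c)%R|%N = (2 ^ k * m)%N ->
    odd m -> (m %| M)%N -> (n <= k)%N ->
    WAM_den (a * b * c) s = 0.
  move=> abc zE om mM nlek; apply/eqP; apply/negPn/negP => den0.
  have m0 : (0 < m)%N by case: m om {zE mM}.
  have T : weighted_Omega sigma m <= W + eps * (2 * n%:R).
    apply: le_trans (weighted_Omega_le hB e0 m0 _) _.
      move=> p; rewrite mem_primes => /and3P[pp _ pm] pB.
      have [-> l1] := hn p pp pB (dvdn_trans pm mM); split => //.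
      by apply: leq_trans l1; apply: dvdn_leq_log => //; rewrite -/M; lia.
    rewrite lerD2l ler_pM2l //.
    apply: (@le_trans _ _ (ln (2 ^ (2 * n))%:R)).
      rewrite ler_ln ?posrE ?ltr0n ?expn_gt0 // ler_nat.
      by apply: leq_trans (leq_pred _); apply: dvdn_leq => //; rewrite -/M; lia.
    (* Here log 2 <= 1 is used, from log (1 + x) <= x. *)
    rewrite natrX lnXn // -[leLHS]mulr_natr natrM ler_piMl // ?mulr_ge0 //.
    by apply: (@le_ln1Dx R 1); lra.
  have big : K * (L + (W + eps * (2 * n%:R))) + (W + eps * (2 * n%:R)) < k%:R * L.
    have e1 : (K + 1) * eps = L / 4.
      by rewrite /eps; field; rewrite gt_eqF.
    have e2 : 2 * (K * L + (K + 1) * W) < n%:R * L by rewrite -ltr_pdivrMr.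
    have e3 : n%:R * L <= k%:R * L by rewrite ler_pM2r // ler_nat.
    have -> : K * (L + (W + eps * (2 * n%:R))) + (W + eps * (2 * n%:R)) =
      K * L + (K + 1) * W + (K + 1) * eps * (2 * n%:R) by ring.
    rewrite e1; lra.
  have k0 : (0 < k)%N by exact: leq_trans nlek.
  have := WAM_gt zE om k0 den0 Kge0 T big.
  apply/negP; rewrite -leNgt; apply: le_trans (ler_norm K0); apply: ubK.
  exists a, b, c; split => //; split => //; rewrite zE.
  apply: (@leq_trans (2 ^ k)); last by rewrite leq_pmulr.
  by apply: leq_trans M1 _; rewrite leq_exp2l.
have denE (k m : nat) (z : int) : (0 < k)%N -> `|z|%N = (2 ^ k * m)%N -> odd m ->
    WAM_den z s = logpow 2 s + prime_sum s m.
  move=> k0 zE om; rewrite /WAM_den zE -/(prime_sum _ _) prime_sumM ?expn_gt0 ?prime_sum2X //.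
    by case: m om {zE}.
  by rewrite coprimeXl // prime_coprime // dvdn2 om.
have tri k : ABC_triple 1 (Posz (2 ^ k).-1) (Posz (2 ^ k)).
  split; first by rewrite gcd1z.
  by have : (0 < 2 ^ k)%N; [rewrite expn_gt0 | lia].
have z1 : logpow 2 s + prime_sum s (2 ^ n).-1 = 0.
  have zE : `|(1 * Posz (2 ^ n).-1 * Posz (2 ^ n))%R|%N = (2 ^ n * (2 ^ n).-1)%N by lia.
  rewrite -(denE _ _ _ n0 zE o2); apply: hit (tri _) zE o2 _ (leqnn _).
  by rewrite ME dvdn_mulr.
have z2 : logpow 2 s + prime_sum s M = 0.
  have zE : `|(1 * Posz M * Posz (2 ^ (2 * n)))%R|%N = (2 ^ (2 * n) * M)%N by lia.
  have oM : odd M by rewrite ME oddM o1 o2.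
  have nn : (n <= 2 * n)%N by lia.
  rewrite -(denE _ _ _ (leq_trans n0 nn) zE oM); exact: hit (tri _) zE oM (dvdnn _) nn.
have z3 : logpow 2 s + prime_sum s (2 ^ n).+1 = 0.
  have zE : `|(Posz (2 ^ n) * 1 * Posz (2 ^ n).+1)%R|%N = (2 ^ n * (2 ^ n).+1)%N by lia.
  rewrite -(denE _ _ _ n0 zE o1); apply: hit zE o1 _ _ => //.
    by split; [rewrite gcd1z gcdz1 | lia].
  by rewrite ME dvdn_mull.
(* Odd numbers that differ by 2 are coprime, so [prime_sum] splits over the two factors of [M]. *)
have co : coprime (2 ^ n).-1 (2 ^ n).+1.
  have -> : (2 ^ n).+1 = ((2 ^ n).-1 + 2)%N by lia.
  by rewrite /coprime gcdnDl -/(coprime _ 2) coprime_sym prime_coprime // dvdn2 o2.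
(* Subtracting [z1] from [z2] kills the sum for 2^n + 1, and [z3] then leaves only the term of the
   prime 2, whose modulus is positive. *)
have : logpow 2 s = 0.
  move: z2; rewrite ME prime_sumM //; last by lia.
  by rewrite addrA z1 add0r => z4; move: z3; rewrite z4 addr0.
move=> /(congr1 (@normc R)); rewrite normc_logpow normc0 => /eqP.
by rewrite gt_eqF.
Qed.
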